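(* Let $P_1,\dots,P_n$ be discrete Borel probability measures on $\mathbb{R}$ with probability mass functions $p_1,\dots,p_n$ respectively (so $p_i(x)=P_i(\{x\})$), and let $A=\{x\in\mathbb{R}:\prod_{i=1}^n p_i(x)>0\}$ be their set of common atoms, where $\emptyset\neq A\subset\mathbb{R}$. Then the conflation $\&(P_1,\dots,P_n)$ exists, and for a Borel probability measure $Q$ on $\mathbb{R}$ the following are equivalent: (i) $Q=\&(P_1,\dots,P_n)$; (ii) $Q=\dfrac{\sum_{x\in A}\delta_x\prod_{i=1}^n p_i(x)}{\sum_{y\in A}\prod_{i=1}^n p_i(y)}$; (iii) $Q$ is the conditional distribution of $X_1$ given that $X_1=X_2=\cdots=X_n$, where $X_1,\dots,X_n$ are independent random variables with distributions $P_1,\dots,P_n$, respectively.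
   Context: $\delta_x$ is the Dirac measure at $x$, and $\|\mu\|$ is the total mass of a Borel sub-probability measure $\mu$. For Borel probability measures $P_1,\dots,P_n$ on $\mathbb{R}$ and $j\in\mathbb{N}$, define the sub-probability measure $$\mu_j(P_1,\dots,P_n)=\sum_{k\in\mathbb{Z}}\ \prod_{i=1}^n P_i\big(((k-1)2^{-j},k2^{-j}]\big)\,\delta_{k2^{-j}}.$$ If $\mu_j(P_1,\dots,P_n)/\|\mu_j(P_1,\dots,P_n)\|$ converges vaguely, as $j\to\infty$, to a Borel probability measure $Q$, then $Q$ is called the conflation of $P_1,\dots,P_n$ and is written $\&(P_1,\dots,P_n)$; one then says the conflation exists. Vague convergence $\nu_j\to\nu$ of sub-probability measures means $\int f\,d\nu_j\to\int f\,d\nu$ for all continuous $f$ vanishing at infinity. *)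

(* Defs.v *)
From HB Require Import structures.
From mathcomp Require Import all_boot all_order all_algebra.
From mathcomp Require Import all_classical all_reals all_analysis.

Set Implicit Arguments.
Unset Strict Implicit.
Unset Printing Implicit Defensive.

Import Order.TTheory GRing.Theory Num.Theory.
Import numFieldNormedType.Exports.

Local Open Scope classical_set_scope.
Local Open Scope ring_scope.
Local Open Scope ereal_scope.

(* The families P_1, ..., P_n with n >= 1 are indexed by 'I_n.+1, so the
   distribution called P_1 is P ord0.  Equality of measures is asserted on
   measurable (Borel) sets only. *)

Section dyadic_product.
Context (R : realType) (n : nat) (P : 'I_n.+1 -> probability R R) (j : nat).

Definition dyadic (k : int) : R := (k%:~R / 2 ^+ j)%R.

Definition dyadic_cell (k : int) : set R :=
  `]dyadic (k - 1)%R, dyadic k]%classic.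

Definition dyadic_product (B : set R) : \bar R :=
  \esum_(k in [set: int])
    (\prod_(i < n.+1) P i (dyadic_cell k)) * \d_(dyadic k) B.

Let weight_ge0 k :
  0 <= \prod_(i < n.+1) P i (dyadic_cell k).
Proof. by apply: prode_ge0 => i _; exact: measure_ge0. Qed.

Let dyadic_product0 : dyadic_product set0 = 0.
Proof. by apply: esum1 => k _; rewrite measure0 mule0. Qed.

Let dyadic_product_ge0 B : 0 <= dyadic_product B.
Proof. by apply: esum_ge0 => k _; exact: mule_ge0. Qed.

Let dyadic_product_sigma_additive : semi_sigma_additive dyadic_product.
Proof.
move=> F mF tF mUF.
pose w k := \prod_(i < n.+1) P i (dyadic_cell k).
pose a k m : \bar R := w k * \d_(dyadic k) (F m).
have a0 k m : 0 <= a k m by rewrite mule_ge0 // weight_ge0.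
have wfin k : w k = (fine (w k))%:E.
  rewrite fineK //; apply: prode_fin_num => i _.
  by apply: fin_num_measure; exact: measurable_itv.
suff -> : dyadic_product (\bigcup_m F m) =
    \sum_(0 <= m <oo) dyadic_product (F m).
  exact: is_cvg_nneseries.
rewrite nneseries_esumT //.
transitivity (\esum_(k in [set: int]) \esum_(m in [set: nat]) a k m).
  apply: eq_esum => k _.
  rewrite measure_semi_bigcup // -nneseries_esumT // /a -/(w k) wfin.
  by rewrite nneseriesZl.
rewrite /dyadic_product esum_esum // esum_esum; last by move=> m k _ _; exact: a0.
apply: (@reindex_esum R _ _ _ _ (fun x : nat * int => (x.2, x.1))).
split => //= [[x y] [x' y'] _ _ [-> ->] //|[x y] _].
by exists (y, x).
Qed.

HB.instance Definition _ := isMeasure.Build _ _ _ dyadic_product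
  dyadic_product0 dyadic_product_ge0 dyadic_product_sigma_additive.

End dyadic_product.

Definition vanishes_at_infinity (R : realType) (f : R -> R) : Prop :=
  f x @[x --> +oo%R] --> (0%R : R) /\ f x @[x --> -oo%R] --> (0%R : R).

Definition vague_cvg (R : realType) (nu : nat -> {measure set R -> \bar R})
    (nu_oo : {measure set R -> \bar R}) : Prop :=
  forall f : R -> R, continuous f -> vanishes_at_infinity f ->
    \int[nu j]_x (f x)%:E @[j --> \oo] --> \int[nu_oo]_x (f x)%:E.

(* mnormalize mu D is mu / mu setT when mu setT is neither 0 nor +oo, and D
   otherwise.  The total mass of dyadic_product P j is at most 1, so the
   positivity requirement, which is what makes the quotient meaningful, rules
   the default \d_0 out. *)
Definition is_conflation (R : realType) (n : nat)
    (P : 'I_n.+1 -> probability R R) (Q : probability R R) : Prop :=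
  (forall j, 0 < dyadic_product P j [set: R]) /\
  vague_cvg (fun j => mnormalize (dyadic_product P j) \d_(0%R : R)) Q.

Definition discrete_probability (R : realType) (P : probability R R) : Prop :=
  exists S : set R, countable S /\ P S = 1.

Definition mass_function (R : realType) (P : probability R R) (x : R) : \bar R :=
  P [set x].

Definition common_atoms (R : realType) (n : nat)
    (P : 'I_n.+1 -> probability R R) : set R :=
  [set x | 0 < \prod_(i < n.+1) mass_function (P i) x].

Definition is_normalized_pmf_product (R : realType) (n : nat)
    (P : 'I_n.+1 -> probability R R) (Q : probability R R) : Prop :=
  forall B : set R, measurable B ->
    Q B = (\esum_(x in common_atoms P)
             \d_x B * \prod_(i < n.+1) mass_function (P i) x) /
          (\esum_(y in common_atoms P)
             \prod_(i < n.+1) mass_function (P i) y).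

Definition mutually_independent (R : realType) (d : measure_display)
    (T : measurableType d) (Pr : probability T R) (m : nat)
    (X : 'I_m -> {RV Pr >-> R}) : Prop :=
  forall B : 'I_m -> set R, (forall i, measurable (B i)) ->
    Pr (\bigcap_i (X i @^-1` B i)) = \prod_(i < m) Pr (X i @^-1` B i).

Definition is_cond_distribution (R : realType) (d : measure_display)
    (T : measurableType d) (Pr : probability T R) (Y : {RV Pr >-> R})
    (E : set T) (Q : probability R R) : Prop :=
  0 < Pr E /\
  forall B : set R, measurable B -> Q B = Pr (Y @^-1` B `&` E) / Pr E.

(* The law of X_1 given X_1 = ... = X_n depends only on P_1, ..., P_n; the
   quantification is over all models of X_1, ..., X_n on any probability
   space. *)
Definition is_cond_distribution_given_all_equal (R : realType) (n : nat)
    (P : 'I_n.+1 -> probability R R) (Q : probability R R) : Prop :=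
  forall (d : measure_display) (T : measurableType d) (Pr : probability T R)
    (X : 'I_n.+1 -> {RV Pr >-> R}),
    mutually_independent X ->
    (forall i (B : set R), measurable B -> distribution Pr (X i) B = P i B) ->
    is_cond_distribution (X ord0) [set w | forall i, X i w = X ord0 w] Q.

(* Main.v *)
From HB Require Import structures.
Require Import Defs.
From mathcomp Require Import all_boot all_order all_algebra.
From mathcomp Require Import all_classical all_reals all_analysis.
From mathcomp Require Import measurable_realfun.

(** Realize P_1, ..., P_n as the laws of independent random variables
X_1, ..., X_n on one probability space, and let E_j be the event that all the
X_i fall in the same dyadic cell of level j.  By independence, the dyadic
product mu_j is exactly the law of X_1, rounded up to the grid of mesh 2^-j,
restricted to E_j ([dyadic_productE]).  The rounding of X_1 tends to X_1, and
the indicator of E_j is eventually equal to that of E = (X_1 = ... = X_n): equal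
values share all cells, distinct values end up in distinct cells.  Dominated
convergence then gives, for every bounded continuous f, that the integral of f
with respect to mu_j tends to the expectation of f(X_1) on E
([cvg_integral_dyadic_product]).  The case f = 1 gives the total masses, so as
soon as E has positive probability the normalized mu_j converge vaguely to the
law of X_1 given E ([is_conflation_conditional_law]).

Discreteness enters only in computing that law: the restriction to E of the law
of X_1 is dominated by P_1, hence carried by a countable set, and it gives
p_1(x)...p_n(x) to each singleton {x} ([equal_lawE]); so the law of X_1 given E
is the normalized product of the mass functions, in every model of
X_1, ..., X_n.  A common atom makes E of positive probability.  Finally a vague
limit is unique among probability measures, because the indicator of an open
ray is a pointwise limit of continuous functions with values in [0, 1] that
vanish at infinity ([eq_probability_vanishing_integrals]). *)

Set Implicit Arguments.
Unset Strict Implicit.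
Unset Printing Implicit Defensive.

Import Order.TTheory GRing.Theory Num.Theory.
Import numFieldNormedType.Exports.

Local Open Scope classical_set_scope.
Local Open Scope ring_scope.
Local Open Scope ereal_scope.

(** * Countable decompositions and restricted laws *)

Section countable_decomposition.
Context d (T : measurableType d) (R : realType).
Variable mu : {measure set T -> \bar R}.

Lemma measure_bigcup_esum (I : choiceType) (D : set I) (F : I -> set T) :
  countable D -> (forall i, D i -> measurable (F i)) -> trivIset D F ->
  mu (\bigcup_(i in D) F i) = \esum_(i in D) mu (F i).
Proof.
elim/choicePpointed: I => I in D F *.
  by rewrite !emptyE bigcup_set0 measure0 esum_set0.
move=> /countable_bijP[B]; rewrite card_eq_sym => /card_set_bijP[f bf] mF tF.
have [fD injf surjf] := bf.
have eF : \bigcup_(i in D) F i = \bigcup_(k in B) F (f k).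
  apply/seteqP; split=> [t [i Di Fit]|t [k Bk Ft]]; last first.
    by exists (f k) => //; exact: fD.
  by have [k Bk fk] := surjf _ Di; exists k => //; rewrite fk.
rewrite eF measure_bigcup.
- rewrite nneseries_esum //.
  rewrite (reindex_esum B D f) //.
  rewrite (_ : [set x | x \in B] = B) //.
  by apply/seteqP; split => x /=; rewrite inE.
- by move=> k Bk; apply: mF; exact: fD.
- move=> i j Bi Bj /(tF _ _ (fD _ Bi) (fD _ Bj)).
  by apply: injf; rewrite inE.
Qed.

End countable_decomposition.

Lemma measure_concentrated (R : realType) (mu : {measure set R -> \bar R})
    (S B : set R) :
  countable S -> mu (~` S) = 0 -> measurable B ->
  mu B = \esum_(x in S) \d_x B * mu [set x].
Proof.
move=> cS muS mB.
have mS : measurable S by exact: countable_measurable.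
have mBS : measurable (B `&` ~` S).
  by apply: measurableI => //; exact: measurableC.
have muBS : mu (B `&` ~` S) = 0.
  by apply: (subset_measure0 _ _ (@subIsetr _ _ _)) => //; exact: measurableC.
have -> : mu B = mu (B `&` S).
  rewrite -[in LHS](setIT B) -(setUv S) setIUr measureU0 //.
  exact: measurableI.
have -> : B `&` S = \bigcup_(x in S) (B `&` [set x]).
  apply/seteqP; split=> [x [Bx Sx]|x [y Sy [Bx xy]]]; first by exists x.
  by split => //; rewrite (_ : x = y).
rewrite measure_bigcup_esum //.
- apply: eq_esum => x _; rewrite diracE.
  have [xB|xB] := boolP (x \in B).
    by rewrite mul1e setIidr // => _ ->; rewrite -inE.
  rewrite mul0e (_ : _ `&` _ = set0) ?measure0 //.
  by apply/seteqP; split => // y [By yx]; move: xB; rewrite -yx notin_setE.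
- by move=> x Sx; exact: measurableI.
- by move=> x y _ _ [z [[_ ->] [_ ->]]].
Qed.

Lemma concentrated_null (R : realType) (P : probability R R) (S : set R) :
  countable S -> P S = 1 -> P (~` S) = 0.
Proof.
move=> cS PS; have mS : measurable S by exact: countable_measurable.
by rewrite probability_setC // PS subee.
Qed.

Lemma bounded_integrable d (T : measurableType d) (R : realType)
    (mu : {measure set T -> \bar R}) (f : T -> R) (M : R) :
  mu [set: T] < +oo -> measurable_fun [set: T] f ->
  (forall x, `|f x| <= M)%R -> mu.-integrable [set: T] (EFin \o f).
Proof.
move=> mufin mf fM; apply: measurable_bounded_integrable => //.
exists M; split; rewrite ?num_real // => M' /ltW MM' x _.
exact: le_trans MM'.
Qed.

Section law_on.
Context d (T : measurableType d) (R : realType) (Pr : probability T R).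
Variables (E : set T) (Y : {mfun T >-> R}).

(** The law of Y restricted to the event E, left unnormalized: B is sent to
the probability that Y lies in B and E occurs.  The proof that E is measurable
is an argument, so that the function carries a structure of measure. *)
Definition law_on of measurable E := fun B : set R => Pr (Y @^-1` B `&` E).

Variable mE : measurable E.
Local Notation law := (law_on mE).

Let law0 : law set0 = 0.
Proof. by rewrite /law_on preimage_set0 set0I measure0. Qed.

Let law_ge0 B : 0 <= law B. Proof. exact: measure_ge0. Qed.

Let law_sigma_additive : semi_sigma_additive law.
Proof.
exact: (@measure_semi_sigma_additive _ _ _ (pushforward (mrestr Pr mE) Y)).
Qed.

HB.instance Definition _ := isMeasure.Build _ _ _ law
  law0 law_ge0 law_sigma_additive.

Lemma law_onE B : law_on mE B = Pr (Y @^-1` B `&` E). Proof. by []. Qed.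

Lemma law_on_setT : law [set: R] = Pr E.
Proof. by rewrite law_onE preimage_setT setTI. Qed.

Lemma integral_law_on (f : R -> R) M : measurable_fun [set: R] f ->
  (forall x, `|f x| <= M)%R ->
  \int[law]_x (f x)%:E = \int[Pr]_w (f (Y w) * \1_E w)%:E.
Proof.
move=> mf fM.
have mfY : measurable_fun [set: T] (f \o Y) by exact: measurableT_comp.
have Pr_fin : Pr E < +oo by rewrite ltey_eq fin_num_measure.
have restrT : mrestr Pr mE [set: T] < +oo by rewrite /mrestr setTI.
have ifY : (mrestr Pr mE).-integrable [set: T] (EFin \o (f \o Y)).
  by apply: bounded_integrable => // w; exact: fM.
(* The law is by definition the image under Y of Pr restricted to E. *)
transitivity (\int[pushforward (mrestr Pr mE) Y]_x (f x)%:E).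
  exact: eq_measure_integral.
rewrite integral_pushforward //=; last exact/measurable_EFinP.
rewrite preimage_setT (negligible_integral (measurableC mE)) //=; last first.
  by rewrite /mrestr setICl measure0.
rewrite setTD setCK (eq_measure_integral Pr); last first.
  by move=> A mA AE /=; rewrite /mrestr setIidl.
rewrite integral_mkcond; apply: eq_integral => w _.
by rewrite patchE indicE; case: ifP => _ /=; rewrite ?mulr1 ?mulr0.
Qed.

End law_on.

(** * Independent families with prescribed laws *)

(** By induction on m, adjoining one factor at a time to a product space. *)
Lemma exists_independent_family (R : realType) (m : nat)
    (P : 'I_m -> probability R R) :
  exists (d : measure_display) (T : measurableType d) (Pr : probability T R)
    (X : 'I_m -> {RV Pr >-> R}),
  forall B : 'I_m -> set R, (forall i, measurable (B i)) ->
    Pr (\bigcap_i (X i @^-1` B i)) = \prod_(i < m) P i (B i).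
Proof.
elim: m P => [|m IHm] P.
  (* With no variable at all any probability space will do. *)
  pose Pr : probability R R := \d_(0%R : R).
  have mid : measurable_fun [set: R] (@idfun R) by exact: measurable_id.
  exists _, _, Pr, (fun=> mfun_Sub (mem_set mid)) => B _.
  rewrite big_ord0 (_ : \bigcap_i _ = [set: R]) ?probability_setT //.
  by apply/seteqP; split => // x _ [].
have [d [T [Pr [X XP]]]] := IHm (fun i => P (lift ord0 i)).
pose Pr' : probability (R * T)%type R := P ord0 \x Pr.
pose X' (i : 'I_m.+1) (w : R * T) : R :=
  if unlift ord0 i is Some k then X k w.2 else w.1.
have mX' i : measurable_fun [set: R * T] (X' i).
  by rewrite /X'; case: (unlift ord0 i) => [k|] //; exact: measurableT_comp.
exists _, _, Pr', (fun i => mfun_Sub (mem_set (mX' i))) => B mB.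
have -> : \bigcap_i (mfun_Sub (mem_set (mX' i)) @^-1` B i) =
    B ord0 `*` \bigcap_k (X k @^-1` B (lift ord0 k)).
  apply/seteqP; split=> [w Xw|w [Bw Xw] i _].
    split=> [|k _]; first by have := Xw ord0 I; rewrite /= /X' unlift_none.
    by have := Xw (lift ord0 k) I; rewrite /= /X' liftK.
  rewrite /= /X'; case: unliftP => [k|] ->; last exact: Bw.
  exact: Xw.
rewrite [LHS]product_measure1E //; last first.
  apply: fin_bigcap_measurable => // k _.
  exact: measurable_funPTI.
rewrite big_ord_recl; congr (_ * _); exact: XP.
Qed.

Section independent_family.
Context d (T : measurableType d) (R : realType) (Pr : probability T R).
Context (m : nat) (X : 'I_m -> {RV Pr >-> R}) (P : 'I_m -> probability R R).
Hypothesis XP : forall B : 'I_m -> set R, (forall i, measurable (B i)) ->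
  Pr (\bigcap_i (X i @^-1` B i)) = \prod_(i < m) P i (B i).

Lemma distribution_of_family i (B : set R) : measurable B ->
  distribution Pr (X i) B = P i B.
Proof.
move=> mB; pose C k := if k == i then B else [set: R].
have mC k : measurable (C k) by rewrite /C; case: ifP.
(* Leave all coordinates other than i unconstrained. *)
transitivity (Pr (\bigcap_k (X k @^-1` C k))).
  congr (Pr _); apply/seteqP; split=> [w Bw k _|w /(_ i I)].
    by rewrite /C /=; case: eqP => // ->.
  by rewrite /C /= eqxx.
rewrite XP // (bigD1 i) //= big1 /C ?eqxx ?mule1 // => k /negbTE ->.
by rewrite probability_setT.
Qed.

Lemma mutually_independent_family : mutually_independent X.
Proof.
move=> B mB; rewrite XP //; apply: eq_bigr => i _.
by rewrite -distribution_of_family.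
Qed.

End independent_family.

(** Converse of the two preceding lemmas: independence together with the
marginal laws determines the probabilities of boxes. *)
Lemma independent_family_prod d (T : measurableType d) (R : realType)
    (Pr : probability T R) (m : nat) (X : 'I_m -> {RV Pr >-> R})
    (P : 'I_m -> probability R R) :
  mutually_independent X ->
  (forall i (B : set R), measurable B -> distribution Pr (X i) B = P i B) ->
  forall B : 'I_m -> set R, (forall i, measurable (B i)) ->
    Pr (\bigcap_i (X i @^-1` B i)) = \prod_(i < m) P i (B i).
Proof.
move=> indX lawX B mB; rewrite indX //; apply: eq_bigr => i _.
by rewrite -lawX.
Qed.

(** * Rounding up to the dyadic grid *)

Section dyadic_rounding.
Context {R : realType}.
Implicit Types (j : nat) (x : R).

(** The index k of the level-j dyadic cell ](k - 1) / 2^j, k / 2^j] that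
contains x. *)
Definition cell_index j x : int := Num.ceil (x * 2 ^+ j)%R.

(** The right end point of the level-j dyadic cell that contains x. *)
Definition dyadic_round j x : R := dyadic R j (cell_index j x).

Lemma dyadic_cellE j k : @dyadic_cell R j k = cell_index j @^-1` [set k].
Proof.
have j0 : (0 < 2 ^+ j :> R)%R by rewrite exprn_gt0.
apply/seteqP; split=> [x /=|x /= <-]; rewrite /dyadic_cell /dyadic /= in_itv /=.
  by rewrite ltr_pdivrMr // ler_pdivlMr // => /ceil_def.
by rewrite ltr_pdivrMr // ler_pdivlMr // ceil_itv.
Qed.

Lemma measurable_cell_index j k : measurable (@cell_index j @^-1` [set k]).
Proof. by rewrite -dyadic_cellE; exact: measurable_itv. Qed.

Lemma measurable_dyadic_round j : measurable_fun [set: R] (@dyadic_round j).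
Proof.
move=> _ B mB; rewrite setTI.
have -> : @dyadic_round j @^-1` B =
    \bigcup_(k in dyadic R j @^-1` B) (cell_index j @^-1` [set k]).
  by apply/seteqP; split=> [x Bx|x [k Bk /= kx]]; [exists (cell_index j x)|
    rewrite /= /dyadic_round kx].
rewrite bigcup_mkcond; apply: countable_bigcupT_measurable.
  exact: countableP.
by move=> k; case: ifP => // _; exact: measurable_cell_index.
Qed.

Lemma dyadic_round_bounds j x : (x <= dyadic_round j x <= x + 2^-1 ^+ j)%R.
Proof.
have j0 : (0 < 2 ^+ j :> R)%R by rewrite exprn_gt0.
have /andP[xlo xhi] := ceil_itv (x * 2 ^+ j)%R.
rewrite /dyadic_round /dyadic ler_pdivlMr // xhi /= ler_pdivrMr // mulrDl.
rewrite exprVn mulVf ?gt_eqF // -lerBlDr ltW //.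
by rewrite /cell_index; move: xlo; rewrite intrB.
Qed.

Lemma cvg_dyadic_round x : dyadic_round j x @[j --> \oo] --> x.
Proof.
apply: (@squeeze_cvgr _ _ _ _ (fun=> x) (fun j => x + 2^-1 ^+ j)%R).
- by apply: nearW => j; exact: dyadic_round_bounds.
- exact: cvg_cst.
- rewrite -[X in _ --> X]addr0; apply: cvgD; first exact: cvg_cst.
  by apply: cvg_expr; rewrite gtr0_norm ?invr_gt0 // invf_lt1 // ltr1n.
Qed.

(** Distinct points are eventually separated by the dyadic cells, since their
roundings converge to distinct limits. *)
Lemma near_cell_index_neq x y : x != y ->
  \forall j \near \oo, cell_index j x != cell_index j y.
Proof.
move=> xy.
have /cvgr_neq0 :
    (dyadic_round j x - dyadic_round j y)%R @[j --> \oo] --> (x - y)%R.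
  by apply: cvgB; exact: cvg_dyadic_round.
rewrite subr_eq0 => /(_ xy); apply: filterS => j.
by apply: contra => /eqP e; rewrite /dyadic_round e subrr.
Qed.

End dyadic_rounding.

(** * Dyadic products and the event of coincidence *)

Section coincidence.
Context d (T : measurableType d) (R : realType) (Pr : probability T R).
Context (n : nat) (X : 'I_n.+1 -> {RV Pr >-> R}).

(** The event that all the variables take the same value. *)
Definition all_equal : set T := [set w | forall i, X i w = X ord0 w].

(** The event that all the variables fall in the same dyadic cell of level
j. *)
Definition same_cell j : set T :=
  [set w | forall i, cell_index j (X i w) = cell_index j (X ord0 w)].

Lemma same_cell_bigcup j : same_cell j =
  \bigcup_k \bigcap_i (X i @^-1` (cell_index j @^-1` [set k])).
Proof.
apply/seteqP; split=> [w Ew|w [k _ Xk] i]; last by rewrite (Xk i) // (Xk ord0).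
by exists (cell_index j (X ord0 w)) => // i _; exact: Ew.
Qed.

Lemma measurable_coincidence_cell j k :
  measurable (\bigcap_i (X i @^-1` (cell_index j @^-1` [set k]))).
Proof.
apply: fin_bigcap_measurable => // i _.
by apply: measurable_funPTI; exact: measurable_cell_index.
Qed.

Lemma measurable_same_cell j : measurable (same_cell j).
Proof.
rewrite same_cell_bigcup; apply: countable_bigcupT_measurable => //.
by move=> k; exact: measurable_coincidence_cell.
Qed.

Lemma near_same_cell w :
  \forall j \near \oo, (w \in same_cell j) = (w \in all_equal).
Proof.
have [wE|] := pselect (all_equal w).
  apply: nearW => j; rewrite (mem_set wE); apply/mem_set => i.
  by rewrite (wE i).
move=> wE; have /existsNP[i /eqP iE] := wE.
rewrite (memNset wE); apply: filterS (near_cell_index_neq iE) => j neq.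
by rewrite memNset // => /(_ i) /eqP; rewrite (negbTE neq).
Qed.

Lemma all_equal_bigcap : all_equal = \bigcap_j same_cell j.
Proof.
apply/seteqP; split=> [w wE j _ i|w wj]; first by rewrite (wE i).
have [j] := filter_ex (near_same_cell w).
by rewrite (mem_set (wj j I)) => /esym/set_mem.
Qed.

Lemma measurable_all_equal : measurable all_equal.
Proof.
rewrite all_equal_bigcap; apply: bigcapT_measurable => j.
exact: measurable_same_cell.
Qed.

(** From here on the X i are independent with laws P i, expressed through the
probabilities of boxes. *)
Context (P : 'I_n.+1 -> probability R R).
Hypothesis XP : forall B : 'I_n.+1 -> set R, (forall i, measurable (B i)) ->
  Pr (\bigcap_i (X i @^-1` B i)) = \prod_(i < n.+1) P i (B i).

(** The variable [X ord0] rounded up to the grid of level j. *)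
Definition rounded_coordinate j : {mfun T >-> R} :=
  mfun_Sub (mem_set (measurableT_comp (measurable_dyadic_round j)
    (measurable_funP (X ord0)))).

(** Splitting the event on the right-hand side by the common cell turns it
into a countable disjoint union of boxes, whose probabilities are the weights of
the dyadic product. *)
Lemma dyadic_productE j (B : set R) : measurable B ->
  dyadic_product P j B =
  law_on Pr (rounded_coordinate j) (measurable_same_cell j) B.
Proof.
move=> mB; rewrite law_onE.
have -> : rounded_coordinate j @^-1` B `&` same_cell j =
    \bigcup_(k in dyadic R j @^-1` B)
      \bigcap_i (X i @^-1` (cell_index j @^-1` [set k])).
  apply/seteqP; split=> [w [Bw wj]|w [k Bk wk]].
    by exists (cell_index j (X ord0 w)) => // i _; exact: wj.
  split; last by move=> i; rewrite (wk i) // (wk ord0).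
  have kE : cell_index j (X ord0 w) = k by exact: (wk ord0 I).
  by rewrite /= /dyadic_round kE.
rewrite measure_bigcup_esum; last 3 first.
- exact: countableP.
- by move=> k _; exact: measurable_coincidence_cell.
- move=> k l _ _ [w [wk wl]].
  by rewrite -(wk ord0 I) -(wl ord0 I).
rewrite [RHS]esum_mkcond /dyadic_product; apply: eq_esum => k _.
rewrite diracE.
have XPk : Pr (\bigcap_i (X i @^-1` (cell_index j @^-1` [set k]))) =
    \prod_(i < n.+1) P i (dyadic_cell j k).
  by rewrite dyadic_cellE; apply: XP => i; exact: measurable_cell_index.
have -> : (k \in dyadic R j @^-1` B) = (dyadic R j k \in B).
  by apply/idP/idP; rewrite !inE.
case: ifP => _; last by rewrite mule0.
by rewrite mule1; exact/esym.
Qed.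

Lemma dyadic_product_setT j : dyadic_product P j [set: R] = Pr (same_cell j).
Proof. by rewrite dyadic_productE // law_on_setT. Qed.

Lemma all_equal_le_dyadic_product j :
  Pr all_equal <= dyadic_product P j [set: R].
Proof.
rewrite dyadic_product_setT; apply: le_measure; rewrite ?inE.
- exact: measurable_all_equal.
- exact: measurable_same_cell.
- by rewrite all_equal_bigcap; exact: bigcap_inf.
Qed.

(** The unnormalized law of the common value of the variables. *)
Definition equal_law : set R -> \bar R :=
  law_on Pr (X ord0) measurable_all_equal.

HB.instance Definition _ := Measure.copy equal_law
  (law_on Pr (X ord0) measurable_all_equal).

Lemma cvg_integral_dyadic_product (f : R -> R) (M : R) :
  continuous f -> (forall x, `|f x| <= M)%R ->
  \int[dyadic_product P j]_x (f x)%:E @[j --> \oo] -->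
  \int[equal_law]_x (f x)%:E.
Proof.
move=> cf fM; have mf : measurable_fun [set: R] f.
  exact: continuous_measurable_fun.
under eq_cvg => j.
  rewrite (eq_measure_integral
    (law_on Pr (rounded_coordinate j) (measurable_same_cell j))); last first.
    by move=> B mB _; exact: dyadic_productE.
  rewrite (integral_law_on _ _ _ mf fM).
  over.
rewrite (integral_law_on _ _ _ mf fM).
apply: (@dominated_cvg _ _ _ _ _ _ _ _ (cst M%:E)) => //.
- move=> j; apply/measurable_EFinP; apply: measurable_funM.
    exact: measurableT_comp.
  by apply: measurable_indic; exact: measurable_same_cell.
- move=> w _; apply: cvg_EFin; first exact: nearW.
  apply: cvgM.
    apply: continuous_cvg; first exact: cf.
    exact: cvg_dyadic_round.
  apply: cvg_near_cst; apply: filterS (near_same_cell w) => j.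
  by rewrite !indicE => ->.
- exact: finite_measure_integrable_cst.
- move=> j w _; rewrite lee_fin normrM.
  rewrite indicE; case: (w \in _); rewrite ?normr1 ?mulr1 ?normr0 ?mulr0.
    exact: fM.
  exact: le_trans (normr_ge0 _) (fM 0%R).
Qed.

Lemma cvg_dyadic_product_mass :
  dyadic_product P j [set: R] @[j --> \oo] --> Pr all_equal.
Proof.
have c1 : continuous (cst 1%R : R -> R) by exact: cst_continuous.
have int1 (mu : {measure set R -> \bar R}) :
    \int[mu]_x (cst 1%R x : R)%:E = mu [set: R].
  by rewrite (@integral_cst _ _ _ mu _ measurableT 1) mul1e.
have := @cvg_integral_dyadic_product (cst 1%R) 1%R c1.
rewrite int1 [X in _ --> X](_ : _ = Pr all_equal); last exact: law_on_setT.
under eq_cvg do rewrite int1.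
by apply => x; rewrite normr1.
Qed.

Lemma equal_law_set1 x :
  equal_law [set x] = \prod_(i < n.+1) mass_function (P i) x.
Proof.
rewrite /equal_law law_onE /mass_function -(XP (B := fun=> [set x])) //.
congr (Pr _); apply/seteqP; split=> [w [Xx wE] i _|w wx].
  by rewrite /= (wE i).
by split=> [|i]; rewrite ?(wx i I) ?(wx ord0 I) //; exact: (wx ord0 I).
Qed.

Lemma equal_law_dominated (B : set R) : measurable B -> equal_law B <= P ord0 B.
Proof.
move=> mB; rewrite /equal_law law_onE -(distribution_of_family XP) //.
apply: le_measure; rewrite ?inE.
- apply: measurableI; first exact: measurable_funPTI.
  exact: measurable_all_equal.
- exact: measurable_funPTI.
- exact: subIsetl.
Qed.

Lemma equal_lawE : discrete_probability (P ord0) ->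
  forall B : set R, measurable B ->
  equal_law B = \esum_(x in common_atoms P)
    \d_x B * \prod_(i < n.+1) mass_function (P i) x.
Proof.
move=> [S [cS PS]] B mB.
have mS : measurable S by exact: countable_measurable.
have P0S : P ord0 (~` S) = 0 by exact: concentrated_null.
have eS : equal_law (~` S) = 0.
  apply/eqP; rewrite eq_le measure_ge0 andbT -P0S equal_law_dominated //.
  exact: measurableC.
transitivity (\esum_(x in S) \d_x B * equal_law [set x]).
  exact: measure_concentrated.
(* The common atoms all lie in S, and the other points of S have weight 0. *)
rewrite [LHS]esum_mkcond [RHS]esum_mkcond; apply: eq_esum => x _.
rewrite equal_law_set1.
case: (boolP (x \in common_atoms P)) => xA; case: (boolP (x \in S)) => xS //.
- move: xA; rewrite inE /common_atoms /= => /lt_eqF.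
  suff : \prod_(i < n.+1) mass_function (P i) x = 0 by move=> ->; rewrite eqxx.
  rewrite big_ord_recl [mass_function _ _](_ : _ = 0) ?mul0e //.
  apply: (subset_measure0 _ _ _ P0S) => //; first exact: measurableC.
  by move=> _ -> Sx; move: xS; rewrite mem_set.
- suff -> : \prod_(i < n.+1) mass_function (P i) x = 0 by rewrite mule0.
  apply/eqP; rewrite eq_le prode_ge0 // andbT leNgt.
  by move: xA; rewrite notin_setE => /negP.
Qed.

End coincidence.

(** * Vague limits and normalization *)

Lemma vanishes_at_infinity_bounded (R : realType) (f : R -> R) :
  continuous f -> vanishes_at_infinity f ->
  exists M, forall x, (`|f x| <= M)%R.
Proof.
move=> cf [/cvgr0_norm_le fy /cvgr0_norm_le fNy].
have [b [_ fb]] := fy _ ltr01; have [a [_ fa]] := fNy _ ltr01.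
have ab : (Num.min a b <= Num.max a b)%R by rewrite ge_min le_max lexx.
have cnf : {within `[Num.min a b, Num.max a b], continuous (fun x => `|f x|%R)}.
  apply: continuous_subspaceT => x.
  by apply: continuous_comp; [exact: cf|exact: norm_continuous].
have [c _ fc] := EVT_max ab cnf.
exists (Num.max 1 `|f c|)%R => x; rewrite le_max.
have [xlo|xlo] := ltP x (Num.min a b).
  by apply/orP; left; apply: fa; rewrite (lt_le_trans xlo) // ge_min lexx.
have [xhi|xhi] := ltP (Num.max a b) x.
  apply/orP; left; apply: fb.
  by rewrite (le_lt_trans _ xhi) // le_max lexx orbT.
by apply/orP; right; apply: fc; rewrite in_itv /= xlo.
Qed.

Section vague_limit_uniqueness.
Context {R : realType}.
Implicit Types (a x : R) (m : nat).

(** Continuous functions with bounded support that approximate the indicator of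
the ray ]a, +oo[ as m grows: the first factor ramps from 0 at a with slope m,
and the second cuts off outside [-m, m]. *)
Definition ray_bump a m x : R :=
  (Num.min 1 (m%:R * Num.max 0 (x - a)) *
   Num.min 1 (Num.max 0 (m%:R - `|x|)))%R.

Lemma continuous_ray_bump a m : continuous (ray_bump a m).
Proof.
move=> x.
have min1 (u : R -> R) : {for x, continuous u} ->
    {for x, continuous (fun y => Num.min 1 (u y))%R}.
  move=> cu; apply: (@continuous_min R R (cst 1%R) u) => //.
  exact: cst_continuous.
have max0 (u : R -> R) : {for x, continuous u} ->
    {for x, continuous (fun y => Num.max 0 (u y))%R}.
  move=> cu; apply: (@continuous_max R R (cst 0%R) u) => //.
  exact: cst_continuous.
apply: cvgM; apply: min1; last apply: max0.
- apply: cvgM; first exact: cvg_cst.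
  by apply: max0; apply: cvgB; [exact: cvg_id|exact: cvg_cst].
- by apply: cvgB; [exact: cvg_cst|exact: norm_continuous].
Qed.

Lemma ray_bump_eq0 a m x : (m%:R <= `|x|)%R -> ray_bump a m x = 0%R.
Proof.
move=> mx; rewrite /ray_bump [Num.max _ (m%:R - _)%R]max_l ?subr_le0 //.
by rewrite [Num.min _ 0%R]min_r ?ler01 ?mulr0.
Qed.

Lemma vanishes_ray_bump a m : vanishes_at_infinity (ray_bump a m).
Proof.
split; apply: cvg_near_cst.
- apply: filterS (nbhs_pinfty_ge (num_real (m%:R : R))) => x mx.
  by apply: ray_bump_eq0; rewrite (le_trans mx) // ler_norm.
- apply: filterS (nbhs_ninfty_le (num_real (- m%:R : R)%R)) => x mx.
  by apply: ray_bump_eq0; rewrite -normrN (le_trans _ (ler_norm _)) // lerNr.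
Qed.

Lemma ray_bump_bounded a m x : (`|ray_bump a m x| <= 1)%R.
Proof.
have h (y : R) : (0 <= y -> 0 <= Num.min 1 y <= 1)%R.
  by move=> y0; rewrite le_min ler01 y0 ge_min lexx.
have m0 (y : R) : (0 <= Num.max 0 y)%R by rewrite le_max lexx.
have /andP[u0 u1] := h _ (mulr_ge0 (ler0n R m) (m0 (x - a)%R)).
have /andP[v0 v1] := h _ (m0 (m%:R - `|x|)%R).
by rewrite /ray_bump ger0_norm ?mulr_ge0 // mulr_ile1.
Qed.

Lemma cvg_ray_bump a x : ray_bump a m x @[m --> \oo] --> (\1_`]a, +oo[ x : R).
Proof.
apply: cvg_near_cst; rewrite indicE mem_setE in_itv /= andbT.
have [ax|xa] := ltP a x; last first.
  apply: nearW => m.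
  rewrite /ray_bump [Num.max _ (x - a)%R]max_l ?subr_le0 // mulr0.
  by rewrite min_r ?ler01 ?mul0r.
have xa0 : (0 < x - a)%R by rewrite subr_gt0.
near=> m; rewrite /ray_bump !max_r ?(ltW xa0) ?min_l ?mulr1 //.
- by rewrite lerBrDr; near: m; exact: nbhs_infty_ger.
- by rewrite -ler_pdivrMr // div1r; near: m; exact: nbhs_infty_ger.
- by rewrite subr_ge0; near: m; exact: nbhs_infty_ger.
Unshelve. all: by end_near.
Qed.

(** Agreement on the functions [ray_bump a m] passes to the open rays, which
form a pi-system generating the Borel sets. *)
Lemma eq_probability_vanishing_integrals (Q Q' : probability R R) :
  (forall f : R -> R, continuous f -> vanishes_at_infinity f ->
    \int[Q]_x (f x)%:E = \int[Q']_x (f x)%:E) ->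
  forall B : set R, measurable B -> Q B = Q' B.
Proof.
move=> QQ'.
have cvg_ray (P : probability R R) a :
    \int[P]_x (ray_bump a m x)%:E @[m --> \oo] --> P `]a, +oo[%classic.
  rewrite -(setIT `]a, +oo[%classic) -integral_indic //.
  apply: (@dominated_cvg _ _ _ _ _ _ _ _ (cst 1)) => //.
  - move=> m; apply/measurable_EFinP; apply: continuous_measurable_fun.
    exact: continuous_ray_bump.
  - move=> x _; apply: cvg_EFin; first exact: nearW.
    exact: cvg_ray_bump.
  - exact: finite_measure_integrable_cst.
  - by move=> m x _; rewrite lee_fin ray_bump_bounded.
apply: (@measure_unique _ _ _ (@RGenOInfty.G R)
  (fun k => `](- k%:R)%R, +oo[%classic)).
- exact: RGenOInfty.measurableE.
- move=> _ _ [a ->] [b ->]; exists (Num.max a b).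
  by apply/seteqP; split=> x /=; rewrite !in_itv /= !andbT gt_max => /andP.
- by move=> k; exists (- k%:R)%R.
- rewrite -subTset => x _; have [k xk] := filter_ex (nbhs_infty_gtr (- x)%R).
  by exists k => //=; rewrite in_itv /= andbT ltrNl.
- move=> _ [a ->].
  have lim_ray P := cvg_lim (@ereal_hausdorff R) (cvg_ray P a).
  refine (etrans (esym (lim_ray _ Q)) (etrans _ (lim_ray _ Q'))).
  congr (lim (_ @ \oo)); apply/funext => m.
  by apply: QQ'; [exact: continuous_ray_bump|exact: vanishes_ray_bump].
- by move=> k; rewrite (le_lt_trans (probability_le1 _ _)) ?ltry.
Qed.

End vague_limit_uniqueness.

Lemma mnormalizeE (R : realType) (mu : {measure set R -> \bar R})
    (D : probability R R) (B : set R) :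
  0 < mu [set: R] -> mu [set: R] < +oo ->
  mnormalize mu D B = mu B * ((fine (mu [set: R]))^-1)%:E.
Proof.
move=> mu0 muoo; rewrite /mnormalize; case: ifPn => //.
by rewrite gt_eqF // lt_eqF.
Qed.

Lemma integral_mnormalize (R : realType) (mu : {measure set R -> \bar R})
    (D : probability R R) (f : R -> R) (M : R) :
  0 < mu [set: R] -> mu [set: R] < +oo ->
  measurable_fun [set: R] f -> (forall x, `|f x| <= M)%R ->
  \int[mnormalize mu D]_x (f x)%:E =
    ((fine (mu [set: R]))^-1)%:E * \int[mu]_x (f x)%:E.
Proof.
move=> mu0 muoo mf fM.
have k0 : (0 <= (fine (mu [set: R]))^-1)%R by rewrite invr_ge0 fine_ge0 // ltW.
have mEf : measurable_fun [set: R] (EFin \o f) by exact/measurable_EFinP.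
have intf : mu.-integrable [set: R] (EFin \o f).
  exact: bounded_integrable fM.
rewrite (eq_measure_integral (mscale (NngNum k0) mu)); last first.
  by move=> A _ _; exact: etrans (mnormalizeE D A mu0 muoo) (muleC _ _).
rewrite integralE [in RHS]integralE.
rewrite !ge0_integral_mscale //=; last 2 first.
- exact: measurable_funeneg.
- exact: measurable_funepos.
rewrite [RHS]muleBr //; apply: fin_num_adde_defl.
by rewrite fin_numN; exact: integrable_neg_fin_num.
Qed.

(** * The conflation as a conditional law *)

Section conflation.
Context (R : realType) (n : nat) (P : 'I_n.+1 -> probability R R).

Lemma eq_is_conflation (Q Q' : probability R R) :
  (forall B : set R, measurable B -> Q B = Q' B) ->
  is_conflation P Q -> is_conflation P Q'.
Proof.
move=> QQ' [mass0 vQ]; split => // f cf vf.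
have -> : \int[Q']_x (f x)%:E = \int[Q]_x (f x)%:E.
  by apply: eq_measure_integral => B mB _; exact/esym/QQ'.
exact: vQ.
Qed.

Lemma is_conflation_unique (Q Q' : probability R R) :
  is_conflation P Q -> is_conflation P Q' ->
  forall B : set R, measurable B -> Q B = Q' B.
Proof.
move=> [_ vQ] [_ vQ']; apply: eq_probability_vanishing_integrals => f cf vf.
exact: cvg_unique (vQ f cf vf) (vQ' f cf vf).
Qed.

Context d (T : measurableType d) (Pr : probability T R).
Context (X : 'I_n.+1 -> {RV Pr >-> R}).
Hypothesis XP : forall B : 'I_n.+1 -> set R, (forall i, measurable (B i)) ->
  Pr (\bigcap_i (X i @^-1` B i)) = \prod_(i < n.+1) P i (B i).

Lemma common_atoms_all_equal_gt0 :
  common_atoms P !=set0 -> 0 < Pr (all_equal X).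
Proof.
move=> [x]; rewrite /common_atoms /= -(equal_law_set1 XP).
move=> /lt_le_trans; apply.
rewrite /equal_law law_onE; apply: le_measure; rewrite ?inE.
- apply: measurableI; first exact: measurable_funPTI.
  exact: measurable_all_equal.
- exact: measurable_all_equal.
- exact: subIsetr.
Qed.

(** The law of [X ord0] given that all the variables are equal.  The Dirac mass
is only the default value used when that event is null. *)
Definition conditional_law : probability R R :=
  mnormalize (equal_law X) \d_(0%R : R).

Hypothesis E0 : 0 < Pr (all_equal X).

Lemma conditional_lawE (B : set R) :
  conditional_law B = Pr (X ord0 @^-1` B `&` all_equal X) / Pr (all_equal X).
Proof.
have Efin : Pr (all_equal X) \is a fin_num.
  by apply: fin_num_measure; exact: measurable_all_equal.
have eqE : equal_law X [set: R] = Pr (all_equal X) by exact: law_on_setT.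
have m0 : 0 < equal_law X [set: R] by rewrite eqE.
have moo : equal_law X [set: R] < +oo by rewrite eqE ltey_eq Efin.
have Einv : (Pr (all_equal X))^-1 = ((fine (Pr (all_equal X)))^-1)%:E.
  by rewrite -[in LHS](fineK Efin) inver gt_eqF // fine_gt0 // E0 ltey_eq Efin.
rewrite Einv -eqE; exact: (mnormalizeE _ _ m0 moo).
Qed.

Lemma is_conflation_conditional_law : is_conflation P conditional_law.
Proof.
have Efin : Pr (all_equal X) \is a fin_num.
  by apply: fin_num_measure; exact: measurable_all_equal.
have eqE : equal_law X [set: R] = Pr (all_equal X) by exact: law_on_setT.
have m0 : 0 < equal_law X [set: R] by rewrite eqE.
have moo : equal_law X [set: R] < +oo by rewrite eqE ltey_eq Efin.
have mass0 j : 0 < dyadic_product P j [set: R].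
  exact: lt_le_trans E0 (all_equal_le_dyadic_product XP j).
have massoo j : dyadic_product P j [set: R] < +oo.
  rewrite (dyadic_product_setT XP) ltey_eq fin_num_measure //.
  exact: measurable_same_cell.
split => // f cf vf.
have [M fM] := vanishes_at_infinity_bounded cf vf.
have mf : measurable_fun [set: R] f by exact: continuous_measurable_fun.
have cvg_inv_mass :
    ((fine (dyadic_product P j [set: R]))^-1)%:E @[j --> \oo] -->
    ((fine (equal_law X [set: R]))^-1)%:E.
  apply: cvg_EFin; first exact: nearW.
  apply: cvgV; first by rewrite gt_eqF // fine_gt0 // m0.
  by apply: fine_cvg; rewrite eqE fineK //; exact: cvg_dyadic_product_mass.
rewrite (integral_mnormalize _ m0 moo mf fM).
under eq_cvg do rewrite (integral_mnormalize _ (mass0 _) (massoo _) mf fM).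
apply: cvgeM; last exact: cvg_integral_dyadic_product cf fM.
  apply: mule_def_fin => //; apply: integrable_fin_num => //.
  exact: bounded_integrable fM.
exact: cvg_inv_mass.
Qed.

End conflation.

(** In any model of the X i, the normalized product of the mass functions is the
law of the first variable given that all are equal. *)
Lemma normalized_pmf_productP (R : realType) (n : nat)
    (P : 'I_n.+1 -> probability R R) (d : measure_display)
    (T : measurableType d) (Pr : probability T R)
    (X : 'I_n.+1 -> {RV Pr >-> R}) (Q : probability R R) :
  (forall B : 'I_n.+1 -> set R, (forall i, measurable (B i)) ->
    Pr (\bigcap_i (X i @^-1` B i)) = \prod_(i < n.+1) P i (B i)) ->
  discrete_probability (P ord0) -> common_atoms P !=set0 ->
  is_normalized_pmf_product P Q <->
  is_cond_distribution (X ord0) (all_equal X) Q.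
Proof.
move=> XP dP A0.
have numE B : measurable B -> \esum_(x in common_atoms P)
    \d_x B * \prod_(i < n.+1) mass_function (P i) x =
    Pr (X ord0 @^-1` B `&` all_equal X).
  by move=> mB; rewrite -(equal_lawE XP dP mB).
have denE : \esum_(y in common_atoms P) \prod_(i < n.+1) mass_function (P i) y =
    Pr (all_equal X).
  rewrite -[in RHS](setTI (all_equal X)) -(preimage_setT (X ord0)) -numE //.
  by apply: eq_esum => x _; rewrite diracT mul1e.
split=> [QE|[_ QE] B mB]; last by rewrite numE // denE; exact: QE.
split=> [|B mB]; first exact: (common_atoms_all_equal_gt0 XP).
by rewrite QE // numE // denE.
Qed.

Theorem theorem3p1 (R : realType) (n : nat)
    (P : 'I_n.+1 -> probability R R)
    (discrete_P : forall i, discrete_probability (P i))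
    (common_atoms_neq0 : common_atoms P !=set0) :
  (exists Q : probability R R, is_conflation P Q) /\
  (forall Q : probability R R,
    (is_conflation P Q <-> is_normalized_pmf_product P Q) /\
    (is_normalized_pmf_product P Q <->
       is_cond_distribution_given_all_equal P Q)).
Proof.
have dP := discrete_P ord0.
have [d [T [Pr [X XP]]]] := exists_independent_family P.
have E0 := common_atoms_all_equal_gt0 XP common_atoms_neq0.
have conflation_Q0 := is_conflation_conditional_law XP E0.
have pmfP Q := normalized_pmf_productP Q XP dP common_atoms_neq0.
split; first by exists (conditional_law X).
move=> Q; split; split.
- move=> conflation_Q; apply/pmfP; split => // B mB.
  rewrite -conditional_lawE //.
  exact: is_conflation_unique conflation_Q conflation_Q0 B mB.
- move=> /pmfP[_ QE]; apply: eq_is_conflation conflation_Q0 => B mB.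
  by rewrite conditional_lawE // QE.
- move=> QE d' T' Pr' X' indX lawX.
  have XP' := independent_family_prod indX lawX.
  exact/(normalized_pmf_productP Q XP' dP common_atoms_neq0).
- move=> condQ; apply/pmfP; apply: condQ.
    exact: mutually_independent_family XP.
  exact: distribution_of_family.
Qed.
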